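(* For all $n\ge 1$, $$\omega W^<_n(\mathbf{x},t) = \sum_{\lambda\vdash n}\frac{d}{dt}\Big(t\,A_{l(\lambda)-1}(t)\prod_{i=1}^{l(\lambda)}[\lambda_i]_t\Big)\frac{p_\lambda(\mathbf{x})}{z_\lambda}.$$
   Context: For $n\ge 1$, $W_n$ is the set of Smirnov words of length $n$: words $w=w_1\cdots w_n$ over the positive integers with $w_i\ne w_{i+1}$ for all $1\le i\le n-1$. Let $\mathbf{x}=x_1,x_2,\dots$ be indeterminates and $x_w:=x_{w_1}\cdots x_{w_n}$. The descent number is $\mathrm{des}(w):=|\{i\in\{1,\dots,n-1\}: w_i>w_{i+1}\}|$. Define $W^<_n(\mathbf{x},t):=\sum_{w\in W_n,\,w_1<w_n} t^{\mathrm{des}(w)}x_w$; it is a polynomial in $t$ with symmetric function coefficients. $\omega$ is the standard involution on symmetric functions taking $e_n$ to $h_n$, applied coefficientwise in $t$. For a partition $\lambda=(\lambda_1\ge\cdots\ge\lambda_{l(\lambda)})$ of $n$, $p_\lambda$ is the power sum symmetric function and $z_\lambda:=\prod_{i\ge1} i^{m_i}m_i!$ where $\lambda$ has $m_i$ parts of size $i$. $A_m(t):=\sum_{\sigma\in\mathfrak{S}_m}t^{\mathrm{des}(\sigma)}$ is the Eulerian polynomial for $m\ge1$, and by convention $A_0(t):=t^{-1}$. $[m]_t:=1+t+\cdots+t^{m-1}$. *)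

(* Defs.v *)
From HB Require Import structures.
From mathcomp Require Import all_boot all_order all_fingroup all_algebra.
From mathcomp Require Import boolp mpoly.

Set Implicit Arguments.
Unset Strict Implicit.
Unset Printing Implicit Defensive.

Import GRing.Theory.
Local Open Scope ring_scope.

(* A formal power series of bounded degree in x_1, x_2, ... is given by its
   truncations f N, obtained by setting x_i = 0 for all i > N.  So the ring
   of symmetric functions is built as the inverse limit (in the category of
   graded rings, whence the bound on the degree) of the rings of symmetric
   polynomials in N variables. *)

Definition mpfam : Type := forall N : nat, {mpoly rat[N]}.

HB.instance Definition _ := Choice.copy mpfam (forall N : nat, {mpoly rat[N]}).

Implicit Types f g h : mpfam.

Definition fam_add f g : mpfam := fun N => f N + g N.
Definition fam_opp f : mpfam := fun N => - f N.
Definition fam_mul f g : mpfam := fun N => f N * g N.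
Definition fam_zero : mpfam := fun N => 0.
Definition fam_one : mpfam := fun N => 1.
Definition fam_scale (c : rat) f : mpfam := fun N => c *: f N.

Lemma famP f g : (forall N, f N = g N) -> f = g.
Proof. by move=> eq_fg; apply: functional_extensionality_dep. Qed.

Fact fam_addA : associative fam_add.
Proof. by move=> f g h; apply: famP => N; apply: addrA. Qed.
Fact fam_addC : commutative fam_add.
Proof. by move=> f g; apply: famP => N; apply: addrC. Qed.
Fact fam_add0 : left_id fam_zero fam_add.
Proof. by move=> f; apply: famP => N; apply: add0r. Qed.
Fact fam_addN : left_inverse fam_zero fam_opp fam_add.
Proof. by move=> f; apply: famP => N; apply: addNr. Qed.

HB.instance Definition _ :=
  GRing.isZmodule.Build mpfam fam_addA fam_addC fam_add0 fam_addN.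

Fact fam_mulA : associative fam_mul.
Proof. by move=> f g h; apply: famP => N; apply: mulrA. Qed.
Fact fam_mulC : commutative fam_mul.
Proof. by move=> f g; apply: famP => N; apply: mulrC. Qed.
Fact fam_mul1 : left_id fam_one fam_mul.
Proof. by move=> f; apply: famP => N; apply: mul1r. Qed.
Fact fam_mulD : left_distributive fam_mul +%R.
Proof. by move=> f g h; apply: famP => N; apply: mulrDl. Qed.
Fact fam_oner_neq0 : fam_one != 0.
Proof.
apply/eqP => /(congr1 (fun f : mpfam => f 0)) /eqP.
by apply/negP; apply: oner_neq0.
Qed.

HB.instance Definition _ := GRing.Zmodule_isComNzRing.Build mpfam
  fam_mulA fam_mulC fam_mul1 fam_mulD fam_oner_neq0.

Fact fam_scaleA a b f : fam_scale a (fam_scale b f) = fam_scale (a * b) f.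
Proof. by apply: famP => N; apply: scalerA. Qed.
Fact fam_scale1 : left_id 1 fam_scale.
Proof. by move=> f; apply: famP => N; apply: scale1r. Qed.
Fact fam_scaleDr : right_distributive fam_scale +%R.
Proof. by move=> a f g; apply: famP => N; apply: scalerDr. Qed.
Fact fam_scaleDl f : {morph fam_scale^~ f : a b / a + b}.
Proof. by move=> a b; apply: famP => N; apply: scalerDl. Qed.

HB.instance Definition _ := GRing.Zmodule_isLmodule.Build rat mpfam
  fam_scaleA fam_scale1 fam_scaleDr fam_scaleDl.

Fact fam_scaleAl (a : rat) (f g : mpfam) : a *: (f * g) = a *: f * g.
Proof. by apply: famP => N; apply: scalerAl. Qed.

HB.instance Definition _ :=
  GRing.Lmodule_isLalgebra.Build rat mpfam fam_scaleAl.

Fact fam_scaleAr (a : rat) (f g : mpfam) : a *: (f * g) = f * (a *: g).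
Proof. by apply: famP => N; apply: scalerAr. Qed.

HB.instance Definition _ :=
  GRing.Lalgebra_isAlgebra.Build rat mpfam fam_scaleAr.

(* The substitution x_{N+1} := 0. *)
Definition restr (N : nat) (p : {mpoly rat[N.+1]}) : {mpoly rat[N]} :=
  p \mPo [tuple oapp (fun j : 'I_N => 'X_j) 0 (unlift ord_max i) | i < N.+1].

HB.instance Definition _ N := GRing.RMorphism.copy (@restr N)
  (comp_mpoly
     [tuple oapp (fun j : 'I_N => 'X_j) 0 (unlift ord_max i) | i < N.+1]).
HB.instance Definition _ N := GRing.Linear.copy (@restr N)
  (comp_mpoly
     [tuple oapp (fun j : 'I_N => 'X_j) 0 (unlift ord_max i) | i < N.+1]).

Definition is_symfun (f : mpfam) : Prop :=
  [/\ forall N, f N \is symmetric,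
      forall N, restr (f N.+1) = f N
    & exists d, forall N, (msize (f N) <= d)%N].

Definition symfun_pred : {pred mpfam} := fun f => `[< is_symfun f >].

Fact symfun_subalg_closed : subalg_closed symfun_pred.
Proof.
split.
- apply/asboolP; split=> [N|N|]; first exact: rpred1.
    exact: rmorph1.
  by exists 1%N => N; rewrite msize1.
- move=> a f g /asboolP[sf cf [df Df]] /asboolP[sg cg [dg Dg]].
  apply/asboolP; split=> [N|N|].
  + exact: rpredD (rpredZ a (sf N)) (sg N).
  + change (restr (a *: f N.+1 + g N.+1) = a *: f N + g N).
    by rewrite linearP /= cf cg.
  + exists (maxn df dg) => N; apply: leq_trans (msizeD_le _ _) _.
    rewrite geq_max !leq_max (leq_trans (msizeZ_le _ _) (Df N)).
    by rewrite (Dg N) orbT.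
- move=> f g /asboolP[sf cf [df Df]] /asboolP[sg cg [dg Dg]].
  apply/asboolP; split=> [N|N|].
  + exact: rpredM (sf N) (sg N).
  + change (restr (f N.+1 * g N.+1) = f N * g N).
    by rewrite rmorphM /= cf cg.
  + exists (df + dg).+1 => N; apply: leq_trans (msizeM_le _ _) _.
    exact: leq_add (Df N) (Dg N).
Qed.

HB.instance Definition _ :=
  GRing.isSubalgClosed.Build rat mpfam symfun_pred
    (GRing.subalg_closed_semi symfun_subalg_closed).
HB.instance Definition _ :=
  GRing.isSubringClosed.Build mpfam symfun_pred
    (GRing.subalg_closedBM symfun_subalg_closed).

Record symfun := Symfun { symfun_val : mpfam; _ : symfun_val \in symfun_pred }.

HB.instance Definition _ := [isSub of symfun for symfun_val].
HB.instance Definition _ := [Choice of symfun by <:].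
HB.instance Definition _ := [SubChoice_isSubComNzRing of symfun by <:].
HB.instance Definition _ := [SubZmodule_isSubLmodule of symfun by <:].
HB.instance Definition _ := [SubNzRing_SubLmodule_isSubLalgebra of symfun by <:].
HB.instance Definition _ := [SubLalgebra_isSubAlgebra of symfun by <:].

Lemma symfunP (f : symfun) : is_symfun (symfun_val f).
Proof. exact/asboolP/(valP f). Qed.

Definition mk_symfun f (fP : is_symfun f) : symfun := Symfun (asboolT fP).

(* The truncation f(x_1, ..., x_N, 0, 0, ...). *)
Definition trunc (N : nat) (f : symfun) : {mpoly rat[N]} := symfun_val f N.

Fact trunc_linear N : linear (trunc N).
Proof. by []. Qed.
HB.instance Definition _ N :=
  GRing.isLinear.Build rat symfun {mpoly rat[N]} _ (trunc N) (trunc_linear N).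

Fact trunc_monoid_morphism N : monoid_morphism (trunc N).
Proof. by []. Qed.
HB.instance Definition _ N :=
  GRing.isMonoidMorphism.Build symfun {mpoly rat[N]} (trunc N)
    (trunc_monoid_morphism N).

Lemma mcoeff_restr N (p : {mpoly rat[N.+1]}) (m : 'X_{1..N}) :
  (restr p)@_m = p@_(mnmwiden m).
Proof.
rewrite [p in LHS]mpolyE [p in RHS]mpolyE (raddf_sum (@restr N)) !raddf_sum /=.
apply: eq_bigr => m' _.
rewrite linearZ /= !mcoeffZ mcoeffX; congr (_ * _).
rewrite /restr comp_mpolyX big_ord_recr /= tnth_mktuple unlift_none /=.
have -> : \prod_(i < N) tnth [tuple oapp (fun j : 'I_N => 'X_j) 0
      (unlift ord_max i) | i < N.+1] (widen_ord (leqnSn N) i)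
      ^+ m' (widen_ord (leqnSn N) i)
    = 'X_[[multinom m' (widen_ord (leqnSn N) i) | i < N]] :> {mpoly rat[N]}.
  rewrite [RHS]mpolyXE_id; apply: eq_bigr => i _; rewrite tnth_mktuple mnmE.
  have -> : widen_ord (leqnSn N) i = lift ord_max i.
    by apply: val_inj; rewrite /= /bump leqNgt ltn_ord.
  by rewrite liftK.
have [m'0|m'_neq0] := eqVneq (m' ord_max) 0%N.
  rewrite m'0 expr0 mulr1 mcoeffX; congr (nat_of_bool _)%:R.
  apply/eqP/eqP => [<-|->]; apply/mnmP => i.
    have [j ->|->] := unliftP ord_max i; last by rewrite mnmwiden_ordmax.
    have -> : lift ord_max j = widen_ord (leqnSn N) j.
      by apply: val_inj; rewrite /= /bump leqNgt ltn_ord.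
    by rewrite mnmwiden_widen mnmE.
  by rewrite mnmE mnmwiden_widen.
rewrite expr0n (negPf m'_neq0) mulr0 mcoeff0.
case: eqP => // m'E; move: m'_neq0; rewrite m'E.
by rewrite mnmwiden_ordmax.
Qed.

Lemma mdeg_mnmwiden N (m : 'X_{1..N}) : mdeg (mnmwiden m) = mdeg m.
Proof.
rewrite !mdegE big_ord_recr /= mnmwiden_ordmax addn0.
by apply: eq_bigr => i _; rewrite mnmwiden_widen.
Qed.

Fact elementary_subproof k : is_symfun (fun N => mesym N rat k).
Proof.
split=> [N|N|]; first exact: mesym_sym.
- apply/mpolyP => m; rewrite mcoeff_restr !mcoeff_mesym.
  rewrite /mechar mdeg_mnmwiden; congr (nat_of_bool (_ && _))%:R.
  apply/forallP/forallP => m_le1 i.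
    by have := m_le1 (widen_ord (leqnSn N) i); rewrite mnmwiden_widen.
  have [j ->|->] := unliftP ord_max i; last by rewrite mnmwiden_ordmax.
  have -> : lift ord_max j = widen_ord (leqnSn N) j.
    by apply: val_inj; rewrite /= /bump leqNgt ltn_ord.
  by rewrite mnmwiden_widen.
- exists k.+1 => N; rewrite mesymE; apply: leq_trans (msize_sum _ _ _) _.
  apply/bigmax_leqP => h /eqP <-; rewrite msizeX ltnS mdegE.
  rewrite -sum1_card (big_mkcond (mem h)) /=.
  by apply: leq_sum => i _; rewrite mnmE.
Qed.
Definition elementary k : symfun := mk_symfun (elementary_subproof k).

Definition mhsym (N k : nat) : {mpoly rat[N]} :=
  \sum_(m : 'X_{1..N < k.+1} | mdeg m == k) 'X_[m].

Lemma mcoeff_mhsym N k m : (mhsym N k)@_m = (mdeg m == k)%:R.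
Proof.
rewrite raddf_sum /=; have [mk|m_neqk] := eqVneq.
  have lt_m : (mdeg m < k.+1)%N by rewrite mk.
  rewrite (bigD1 (BMultinom lt_m)) /= ?mk // mcoeffX eqxx big1 ?addr0 //.
  move=> m' /andP[_ m'_neq]; rewrite mcoeffX; case: eqP => // m'E.
  by case/eqP: m'_neq; apply: val_inj.
rewrite big1 // => m' /eqP m'k; rewrite mcoeffX; case: eqP => // m'E.
by rewrite -m'E m'k eqxx in m_neqk.
Qed.

Fact homogeneous_subproof k : is_symfun (mhsym^~ k).
Proof.
split=> [N|N|].
- apply/issymP => s; apply/mpolyP => m.
  by rewrite mcoeff_sym !mcoeff_mhsym mdeg_mperm.
- by apply/mpolyP => m; rewrite mcoeff_restr !mcoeff_mhsym mdeg_mnmwiden.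
- exists k.+1 => N; apply: leq_trans (msize_sum _ _ _) _.
  by apply/bigmax_leqP => m /eqP mk; rewrite msizeX mk.
Qed.
Definition homogeneous k : symfun := mk_symfun (homogeneous_subproof k).

Definition mpsum (N k : nat) : {mpoly rat[N]} := \sum_(i < N) 'X_i ^+ k.

(* For k = 0 the sum is N, which is not stable under truncation. *)
Fact power_sum_subproof k : is_symfun (fun N => mpsum N k.+1).
Proof.
split=> [N|N|].
- apply/issymP => s; rewrite (raddf_sum (msym s)) /=.
  rewrite [RHS](reindex_inj (@perm_inj _ s)).
  apply: eq_bigr => i _ /=; rewrite (rmorphXn (msym s)) /=.
  by rewrite /msym mmapX mmap1U.
- rewrite (raddf_sum (@restr N)) big_ord_recr /= rmorphXn /= {2}/restr comp_mpolyXU.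
  rewrite -tnth_nth tnth_mktuple unlift_none /= expr0n addr0.
  apply: eq_bigr => i _; rewrite rmorphXn /= /restr comp_mpolyXU.
  rewrite -tnth_nth tnth_mktuple.
  have -> : widen_ord (leqnSn N) i = lift ord_max i.
    by apply: val_inj; rewrite /= /bump leqNgt ltn_ord.
  by rewrite liftK.
- exists k.+2 => N; apply: leq_trans (msize_sum _ _ _) _.
  apply/bigmax_leqP => i _; rewrite mpolyXn msizeX ltnS.
  by rewrite mdegMn mdeg1 mul1n.
Qed.
(* The power sum p_k for k > 0; p_0 is never used. *)
Definition power_sum k : symfun :=
  if k is j.+1 then mk_symfun (power_sum_subproof j) else 1.

Definition is_part (n : nat) (la : seq nat) : bool :=
  [&& sorted geq la, 0%N \notin la & sumn la == n].

Record intpart (n : nat) := IntPart { parts :> seq nat; _ : is_part n parts }.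

HB.instance Definition _ n := [isSub of intpart n for @parts n].
HB.instance Definition _ n := [Countable of intpart n by <:].

Lemma intpart_size n (la : intpart n) : (size la <= n)%N.
Proof.
case: la => s /= /and3P[_ s0 /eqP <-].
elim: s s0 => //= x s IHs; rewrite inE negb_or eq_sym -lt0n => /andP[x0 /IHs].
by move=> le_s; rewrite -add1n leq_add.
Qed.

Lemma intpart_le n (la : intpart n) i : i \in parts la -> (i <= n)%N.
Proof.
case: la => s /= /and3P[_ _ /eqP <-] i_s.
by rewrite (perm_sumn (perm_to_rem i_s)) leq_addr.
Qed.

Definition intpart_code n (la : intpart n) : n.-bseq 'I_n.+1 :=
  insub_bseq n [seq inord i | i <- la].
Definition intpart_decode n (b : n.-bseq 'I_n.+1) : option (intpart n) :=
  insub [seq val i | i <- b].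

Lemma intpart_codeK n : pcancel (@intpart_code n) (@intpart_decode n).
Proof.
move=> la; rewrite /intpart_decode /intpart_code /insub_bseq.
rewrite insubdK; last by rewrite -topredE /= size_map intpart_size.
have -> : [seq val i | i <- [seq inord i | i <- la] : seq 'I_n.+1] = la.
  rewrite -map_comp map_id_in // => i i_la /=.
  by rewrite inordK // ltnS (intpart_le i_la).
exact: valK.
Qed.

HB.instance Definition _ n : isFinite (intpart n) :=
  PCanIsFinite (@intpart_codeK n).

Definition zcoef n (la : intpart n) : nat :=
  \prod_(1 <= i < n.+1) (i ^ count_mem i la * (count_mem i la)`!)%N.

Definition power_sum_part n (la : intpart n) : symfun :=
  \prod_(i <- la) power_sum i.

Definition des (w : seq nat) : nat :=
  #|[set i : 'I_(size w).-1 | (nth 0 w i.+1 < nth 0 w i)%N]|.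

Definition smirnov (w : seq nat) : bool := sorted [rel a b | a != b] w.

(* The truncation W_n^<(x_1, ..., x_N, 0, 0, ...; t), a polynomial in t: the
   words surviving the truncation are those on N letters.  The letters
   1, ..., N are represented by 0, ..., N - 1. *)
Definition smirnov_lt (N n : nat) : {poly {mpoly rat[N]}} :=
  \sum_(w : n.-tuple 'I_N
        | smirnov (map val w) && (head 0 (map val w) < last 0 (map val w))%N)
     (\prod_(i <- w) 'X_i) *: 'X^(des (map val w)).

Definition eulerian (m : nat) : {poly rat} :=
  \sum_(s : 'S_m) 'X^(des [seq val (s i) | i : 'I_m]).

(* t * A_m(t), where A_0(t) = t^-1 by convention. *)
Definition tEulerian (m : nat) : {poly rat} :=
  if m is 0 then 1 else 'X * eulerian m.

Definition tint (m : nat) : {poly rat} := \sum_(j < m) 'X^j.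

(* Main.v *)
Require Import Defs.
From mathcomp Require Import all_boot all_order all_fingroup all_algebra.
From mathcomp Require Import mpoly.
From HB Require Import structures.
From mathcomp Require Import boolp ring zify.

(* Let M be the matrix indexed by the letters with M_ij = x_i if i < j,
   t x_i if i > j and 0 if i = j, so that tr M^n enumerates the Smirnov words
   with w_1 <> w_n by cyclic descents.  All positions of a cyclic word being
   equivalent, singling out one of its cyclic descents gives
   n W_n^< = d/dt (tr M^n).  A rank one perturbation of 1 - z M to a lower
   or an upper triangular matrix gives
     Q(z) := det (1 - z M) = sum_k (1 - [k]_t) e_k z^k,
   that is (1 - t) Q(z) = E(tz) - t E(z), and Newton's identities say that
   Q(z) sum_n tr (M^n) z^n = - z Q'(z).  These relations determine omega (tr M^n)
   once e_k is replaced by h_k.  With P := sum_k [k]_t p_k z^k / k one has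
   H(z) / H(tz) = exp ((1 - t) P), and sum_m t A_m(t) u^m / m!, where t A_0 = 1,
   is (1 - t) / (1 - t exp ((1 - t) u)); hence U := sum_m t A_m P^m / m! satisfies
   Q U = H(tz), and the solution is z P' U - sum_k p_k z^k.  Its coefficient of
   z^n is n times the sum over partitions of the theorem (before d/dt) minus
   p_n, which d/dt kills. *)


Import GRing.Theory.
Local Open Scope ring_scope.

Set Implicit Arguments.
Unset Strict Implicit.
Unset Printing Implicit Defensive.

(** * Formal power series *)

Definition series (R : Type) : Type := nat -> R.
HB.instance Definition _ (R : choiceType) := Choice.copy (series R) (nat -> R).

Section SeriesRing.
Variable R : comNzRingType.
Implicit Types f g h : series R.

Definition series_add f g : series R := fun n => f n + g n.
Definition series_opp f : series R := fun n => - f n.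
Definition series_zero : series R := fun=> 0.
Definition series_one : series R := fun n => (n == 0)%:R.
Definition series_mul f g : series R :=
  fun n => \sum_(i < n.+1) f i * g (n - i)%N.

Lemma seriesP f g : f =1 g -> f = g.
Proof. by move=> eq_fg; apply: functional_extensionality_dep. Qed.

Fact series_addA : associative series_add.
Proof. by move=> f g h; apply: seriesP => n; apply: addrA. Qed.
Fact series_addC : commutative series_add.
Proof. by move=> f g; apply: seriesP => n; apply: addrC. Qed.
Fact series_add0 : left_id series_zero series_add.
Proof. by move=> f; apply: seriesP => n; apply: add0r. Qed.
Fact series_addN : left_inverse series_zero series_opp series_add.
Proof. by move=> f; apply: seriesP => n; apply: addNr. Qed.

HB.instance Definition _ := GRing.isZmodule.Build (series R)
  series_addA series_addC series_add0 series_addN.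

(** A coefficient of a product only sees truncations of the factors, so the ring axioms are
    inherited from polynomials. *)
Lemma series_mul_poly N f g n : (n < N)%N ->
  series_mul f g n = (\poly_(i < N) f i * \poly_(i < N) g i)`_n.
Proof.
move=> lt_nN; rewrite coefM; apply: eq_bigr => i _; rewrite !coef_poly.
by rewrite !(leq_ltn_trans _ lt_nN) ?leq_subr // -ltnS.
Qed.

Lemma eq_series_mul f f' g g' n :
  (forall i, (i <= n)%N -> f i = f' i) -> (forall i, (i <= n)%N -> g i = g' i) ->
  series_mul f g n = series_mul f' g' n.
Proof.
by move=> eqf eqg; apply: eq_bigr => i _; rewrite eqf ?leq_ord // eqg ?leq_subr.
Qed.

Lemma series_mul_coef (p q : {poly R}) n :
  series_mul (fun i => p`_i) (fun i => q`_i) n = (p * q)`_n.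
Proof. by rewrite coefM. Qed.

Fact series_mulC : commutative series_mul.
Proof.
by move=> f g; apply: seriesP => n; rewrite !(@series_mul_poly n.+1) // mulrC.
Qed.
Fact series_mulA : associative series_mul.
Proof.
move=> f g h; apply: seriesP => n; pose P k := \poly_(i < n.+1) (k : series R) i.
have E k i : (i <= n)%N -> k i = (P k)`_i by move=> le_i; rewrite coef_poly ltnS le_i.
rewrite (@eq_series_mul _ (fun i => (P f)`_i) _ (fun i => (P g * P h)`_i)).
- rewrite series_mul_coef mulrA -series_mul_coef; apply: eq_series_mul => i le_i.
    by rewrite (@series_mul_poly n.+1).
  by rewrite -E.
- exact: E.
- by move=> i le_i; rewrite (@series_mul_poly n.+1).
Qed.
Fact series_mul1 : left_id series_one series_mul.
Proof.
move=> f; apply: seriesP => n; rewrite /series_mul big_ord_recl big1.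
  by rewrite /series_one mul1r subn0 addr0.
by move=> i _; rewrite /series_one mul0r.
Qed.
Fact series_mulD : left_distributive series_mul series_add.
Proof.
move=> f g h; apply: seriesP => n; rewrite /series_mul /series_add -big_split.
by apply: eq_bigr => i _; rewrite mulrDl.
Qed.
Fact series_one_neq0 : series_one != series_zero.
Proof.
apply/eqP => /(congr1 (fun f : series R => f 0)) /eqP.
by apply/negP; apply: oner_neq0.
Qed.
HB.instance Definition _ := GRing.Zmodule_isComNzRing.Build (series R)
  series_mulA series_mulC series_mul1 series_mulD series_one_neq0.

Lemma series_addE f g n : (f + g) n = f n + g n. Proof. by []. Qed.
Lemma series_oppE f n : (- f) n = - f n. Proof. by []. Qed.
Lemma series_mulE f g n : (f * g) n = \sum_(i < n.+1) f i * g (n - i)%N.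
Proof. by []. Qed.
Lemma series_oneE n : (1 : series R) n = (n == 0)%:R. Proof. by []. Qed.
Lemma series_mulrnE f k n : (f *+ k) n = f n *+ k.
Proof. by elim: k => [|k IHk] //; rewrite !mulrS -IHk. Qed.

Definition seriesC (c : R) : series R := fun n => if n is 0 then c else 0.

Lemma seriesC_mul c f n : (seriesC c * f) n = c * f n.
Proof.
by rewrite series_mulE big_ord_recl big1 ?addr0 ?subn0 // => i _; apply: mul0r.
Qed.

Lemma series_mul0 f g : (f * g) 0%N = f 0%N * g 0%N.
Proof. by rewrite series_mulE big_ord1. Qed.

(* The derivation z d/dz. *)
Definition theta f : series R := fun n => f n *+ n.

Lemma thetaM f g : theta (f * g) = theta f * g + f * theta g.
Proof.
apply: seriesP => n; rewrite /theta series_addE !series_mulE -sumrMnl -big_split /=.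
apply: eq_bigr => i _; rewrite mulrnAl mulrnAr -mulrnDr subnKC //.
by rewrite -ltnS.
Qed.

Lemma thetaD f g : theta (f + g) = theta f + theta g.
Proof. by apply: seriesP => n; apply: mulrnDl. Qed.
Lemma thetaN f : theta (- f) = - theta f.
Proof. by apply: seriesP => n; apply: mulNrn. Qed.
Lemma thetaMn f k : theta (f *+ k) = theta f *+ k.
Proof. by apply: seriesP => n; rewrite /theta !series_mulrnE mulrnAC. Qed.

(* Substitution of t z for z. *)
Definition dilate (t : R) f : series R := fun n => t ^+ n * f n.

Lemma dilateM t f g : dilate t (f * g) = dilate t f * dilate t g.
Proof.
apply: seriesP => n; rewrite /dilate !series_mulE mulr_sumr; apply: eq_bigr => i _.
by rewrite mulrACA -exprD subnKC // -ltnS.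
Qed.
Lemma theta_dilate t f : theta (dilate t f) = dilate t (theta f).
Proof. by apply: seriesP => n; rewrite /theta /dilate mulrnAr. Qed.

(** The inverse is the geometric series in [e = 1 - f]: as [e] has no constant term, [e ^+ k]
    vanishes below degree [k], and the partial sums [G k] stabilise in each degree. *)
Lemma series_inverse f : f 0%N = 1 -> exists g, f * g = 1.
Proof.
move=> f0; pose e : series R := 1 - f.
have e0 : e 0%N = 0 by rewrite /e series_addE series_oppE f0 subrr.
have ek k : forall n, (n < k)%N -> (e ^+ k) n = 0.
  elim: k => // k IHk n lt_nk; rewrite exprS series_mulE big_ord_recl e0 mul0r add0r.
  apply: big1 => i _; rewrite IHk ?mulr0 //= /bump /= add1n.
  by case: n i lt_nk => [[]|n i] //= lt_nk; rewrite subSS (leq_ltn_trans (leq_subr _ _)).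
pose G k : series R := \sum_(i < k) e ^+ i.
have GE k n : (n < k)%N -> G k n = G n.+1 n.
  elim: k => // k IHk; rewrite ltnS leq_eqVlt => /predU1P[-> //|lt_nk].
  by rewrite {1}/G big_ord_recr /= series_addE ek // addr0; apply: IHk.
exists (fun n => G n.+1 n); apply: seriesP => n.
transitivity ((f * G n.+1) n).
  apply: eq_series_mul => // i le_in; rewrite GE //.
have -> : f * G n.+1 = 1 - e ^+ n.+1.
  by rewrite -opprB subrX1 -mulNr opprB /e opprB addrC subrK.
by rewrite series_addE series_oppE ek // subr0.
Qed.

End SeriesRing.

(** As [b 0 = 0], coefficient [n] of [b * K] involves only earlier coefficients of [K], so the
    equation makes them vanish one after another. *)
Lemma series_linear_ode0 (R : comNzRingType) (b K : series R) :
  (forall n (x : R), x *+ n.+1 = 0 -> x = 0) -> b 0%N = 0 -> K 0%N = 0 ->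
  theta K = b * K -> K = 0.
Proof.
move=> inj b0 K0 ode; apply: seriesP => n; elim/ltn_ind: n => -[|n] IHn //.
apply: (inj n); change (theta K n.+1 = 0).
rewrite ode series_mulE big_ord_recl b0 mul0r add0r big1 // => i _.
by rewrite IHn ?mulr0 //= /bump leq0n add1n ltnS subSS leq_subr.
Qed.

Definition map_series (R S : Type) (f : R -> S) (u : series R) : series S :=
  fun n => f (u n).

Lemma map_seriesM (R S : comNzRingType) (f : {rmorphism R -> S}) (u v : series R) :
  map_series f (u * v) = map_series f u * map_series f v.
Proof.
apply: seriesP => n; rewrite /map_series !series_mulE rmorph_sum.
by apply: eq_bigr => i _; rewrite rmorphM.
Qed.

(** * Exponential series over partitions *)

Section Ode.
Variable R : comNzRingType.
Implicit Types (p a H Q U : series R) (c t : R).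

Lemma theta_seriesC c f : theta (seriesC c * f) = seriesC c * theta f.
Proof. by apply: seriesP => n; rewrite /theta !seriesC_mul mulrnAr. Qed.

(** To be read with [H], [p], [Q] the series of [h_k], [p_k], [(1 - [k]_t) h_k], and
    [U = \sum_m t A_m P^m / m!]. Where one would divide by [1 - t], the identity is proved after
    multiplication by this regular element. *)
Lemma newton_quotient t H p a Q U (br : nat -> R) :
    (forall n (x : R), x *+ n.+1 = 0 -> x = 0) ->
    (forall x, (1 - t) * x = 0 -> x = 0) ->
    (forall n, (1 - t) * br n = 1 - t ^+ n) -> br 0%N = 0 ->
    H 0%N = 1 -> p 0%N = 0 -> theta H = p * H ->
    (forall n, a n = br n * p n) -> (forall n, Q n = (1 - br n) * H n) ->
    U 0%N = 1 -> theta U = a * U * (U - seriesC (1 - t)) ->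
  Q * (a * U - p) = - theta Q.
Proof.
move=> nat_reg reg brE br0 H0 p0 thH aE QE U0 thU.
pose c := seriesC (1 - t); pose s := seriesC t.
pose Hd := dilate t H; pose pd := dilate t p.
have c_reg f : c * f = 0 -> f = 0.
  move=> cf0; apply: seriesP => n; apply: reg.
  by rewrite -seriesC_mul -/c cf0.
have cQ : c * Q = Hd - s * H.
  apply: seriesP => n; rewrite series_addE series_oppE !seriesC_mul QE /Hd /dilate.
  by rewrite mulrA mulrBr brE; ring.
have ca : c * a = p - pd.
  apply: seriesP => n; rewrite series_addE series_oppE seriesC_mul aE /pd /dilate.
  by rewrite mulrA brE; ring.
have thHd : theta Hd = pd * Hd by rewrite theta_dilate thH dilateM.
have thcQ : c * theta Q = pd * Hd - s * (p * H).
  by rewrite -theta_seriesC -/c cQ thetaD thetaN theta_seriesC -/s thH thHd.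
have saH : s * a * H + theta Q = pd * Q.
  apply/eqP; rewrite -subr_eq0; apply/eqP/c_reg.
  have -> : c * (s * a * H + theta Q - pd * Q) =
    s * (c * a) * H + c * theta Q - pd * (c * Q) by ring.
  by rewrite ca thcQ cQ; ring.
(* The difference of the two sides has zero constant term. By the Riccati equation for [U] and
   [c * Q + s * H = Hd], [theta] multiplies it by [a * U + pd], so it is zero. *)
have QU : Q * U = Hd.
  apply/eqP; rewrite -subr_eq0; apply/eqP.
  apply: (@series_linear_ode0 _ (a * U + pd)) => //.
  - by rewrite series_addE series_mul0 /pd /dilate aE p0 !mulr0 mul0r addr0.
  - by rewrite series_addE series_oppE series_mul0 QE /Hd /dilate br0 U0 H0; ring.
  - rewrite thetaD thetaN thetaM thHd thU.
    have -> : theta Q = pd * Q - s * a * H by rewrite -saH; ring.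
    have -> : (pd * Q - s * a * H) * U + Q * (a * U * (U - seriesC (1 - t))) -
      pd * Hd = (pd * Q - s * a * H) * U + a * U * (Q * U - c * Q) - pd * Hd.
      by rewrite -/c; ring.
    by rewrite cQ; ring.
apply/eqP; rewrite -addr_eq0; apply/eqP/c_reg.
have -> : c * (Q * (a * U - p) + theta Q) =
  (c * a) * (Q * U) - p * (c * Q) + c * theta Q by ring.
by rewrite QU ca thcQ cQ; ring.
Qed.
End Ode.

Lemma sum_triangle (V : zmodType) n (F : nat -> nat -> V) :
    (forall k l, (n < k + l)%N -> F k l = 0) ->
  \sum_(k < n.+1) \sum_(l < n.+1) F k l =
  \sum_(s < n.+1) \sum_(k < s.+1) F k (s - k)%N.
Proof.
move=> F0; pose G k s := if (k <= s)%N then F k (s - k)%N else 0.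
transitivity (\sum_(k < n.+1) \sum_(s < n.+1) G k s).
  apply: eq_bigr => k _; rewrite -!(big_mkord xpredT).
  have le_k : (k <= n.+1)%N by rewrite ltnW.
  rewrite [RHS](@big_cat_nat _ _ _ k) //= [X in X + _]big1_seq ?add0r; last first.
    by move=> s /=; rewrite mem_index_iota /G => /andP[_ lt_s]; rewrite leqNgt lt_s.
  rewrite -{2}[nat_of_ord k]add0n big_addn.
  rewrite (@big_cat_nat _ _ _ (n.+1 - k)) ?leq_subr //=.
  rewrite [X in _ + X]big1_seq ?addr0; last first.
    move=> l; rewrite mem_index_iota => /andP[_ /andP[le_l _]]; apply: F0.
    by rewrite -leq_subLR.
  by apply: eq_bigr => l _; rewrite /G leq_addl addnK.
rewrite exchange_big; apply: eq_bigr => s _ /=.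
rewrite (big_ord_widen n.+1 (fun k => F k (s - k)%N)) ?ltn_ord //.
by rewrite [RHS]big_mkcond; apply: eq_bigr => k _; rewrite ltnS.
Qed.

(** This is [zcoef] on bare sequences, with the range of the product independent of the sum, so that
    it can be followed when a part is added. *)
Definition zseq N (s : seq nat) : nat :=
  \prod_(1 <= i < N.+1) (i ^ count_mem i s * (count_mem i s)`!)%N.

Lemma zseq_perm N s s' : perm_eq s s' -> zseq N s = zseq N s'.
Proof. by move=> /seq.permP eq_s; apply: eq_bigr => i _; rewrite eq_s. Qed.

Lemma zseq_cons N k s : (0 < k <= N)%N ->
  zseq N (k :: s) = (k * (count_mem k s).+1 * zseq N s)%N.
Proof.
move=> k_N; have k_in : k \in index_iota 1 N.+1 by rewrite mem_index_iota ltnS.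
rewrite /zseq !(bigD1_seq k) ?iota_uniq //= eqxx add1n expnS factS.
rewrite (eq_bigr (fun i => i ^ count_mem i s * (count_mem i s)`!)%N).
  by rewrite !mulnA; congr (_ * _)%N; rewrite -!mulnA; congr (_ * _)%N; rewrite mulnCA.
by move=> i; rewrite eq_sym => /negPf ->.
Qed.

Lemma zseq_widen m N s : all (fun i => i <= m)%N s -> (m <= N)%N ->
  zseq N s = zseq m s.
Proof.
move=> s_m le_mN; rewrite /zseq (@big_cat_nat _ _ _ m.+1) //=.
rewrite [X in (_ * X)%N]big1_seq ?muln1 // => i.
rewrite mem_index_iota => /andP[_ /andP[lt_mi _]].
suff /count_memPn -> : i \notin s by [].
by apply/negP => /(allP s_m); rewrite leqNgt lt_mi.
Qed.

(** * Inserting and removing a part of a partition *)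

Lemma part_nseq n : is_part n (nseq n 1%N).
Proof.
apply/and3P; split; last by rewrite sumn_nseq mul1n.
  by apply/(sortedP 0%N) => i; rewrite size_nseq => lt_i; rewrite !nth_nseq lt_i (ltnW lt_i).
by rewrite mem_nseq andbF.
Qed.

(** Made total so that insertion and removal of a part can serve in a reindexing; a sequence that is
    not a partition of [n] goes to the partition into ones. *)
Definition to_part n (s : seq nat) : intpart n := insubd (IntPart (part_nseq n)) s.

Lemma part_ins n k (mu : intpart (n - k)) : (0 < k <= n)%N ->
  is_part n (sort geq (k :: mu)).
Proof.
case/andP=> k_gt0 le_kn; case: mu => s /= /and3P[_ s0 /eqP sum_s].
have ps : perm_eq (sort geq (k :: s)) (k :: s) by exact/permPl/perm_sort.
apply/and3P; split.
- by apply: sort_sorted => x y; apply: leq_total.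
- by rewrite (perm_mem ps) inE negb_or s0 eq_sym -lt0n k_gt0.
- by rewrite (perm_sumn ps) /= sum_s subnKC.
Qed.

Lemma part_rem n k (la : intpart n) : k \in parts la -> is_part (n - k) (rem k la).
Proof.
case: la => s /= /and3P[sort_s s0 /eqP sum_s] k_s; apply/and3P; split.
- apply: subseq_sorted sort_s; last exact: rem_subseq.
  by move=> x y z /= yx zy; apply: leq_trans yx.
- by apply: contra s0; apply: mem_rem.
- by rewrite -sum_s (perm_sumn (perm_to_rem k_s)) /= addKn.
Qed.

Lemma to_part_ins n k (mu : intpart (n - k)) : (0 < k <= n)%N ->
  parts (to_part n (sort geq (k :: mu))) = sort geq (k :: mu).
Proof. by move=> k_n; apply: insubdK; apply: part_ins. Qed.

Lemma to_part_rem n k (la : intpart n) : k \in parts la ->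
  parts (to_part (n - k) (rem k la)) = rem k la.
Proof. by move=> k_la; apply: insubdK; apply: part_rem. Qed.

Lemma geq_sorted_eq (s s' : seq nat) :
  sorted geq s -> sorted geq s' -> perm_eq s s' -> s = s'.
Proof.
apply: sorted_eq => [x y z /= yx zy|x y /andP[yx xy]]; first exact: leq_trans yx.
by apply/eqP; rewrite eqn_leq; apply/andP.
Qed.

Lemma insK n k (mu : intpart (n - k)) : (0 < k <= n)%N ->
  to_part (n - k) (rem k (to_part n (sort geq (k :: mu)))) = mu.
Proof.
move=> k_n; have pE := to_part_ins mu k_n.
have k_in : k \in parts (to_part n (sort geq (k :: mu))).
  by rewrite pE mem_sort mem_head.
apply: val_inj => /=; rewrite to_part_rem //.
have /and3P[srt _ _] := part_rem k_in.
apply: geq_sorted_eq => //; first by have /and3P[] := valP mu.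
rewrite -(perm_cons k) -(permPl (perm_to_rem k_in)) pE; exact/permPl/perm_sort.
Qed.

Lemma remK n k (la : intpart n) : (0 < k)%N -> k \in parts la ->
  to_part n (sort geq (k :: to_part (n - k) (rem k la))) = la.
Proof.
move=> k_gt0 k_la; have k_n : (0 < k <= n)%N by rewrite k_gt0 (intpart_le k_la).
apply: val_inj => /=; rewrite to_part_ins //; apply: geq_sorted_eq.
- by apply: sort_sorted => x y; apply: leq_total.
- by have /and3P[] := valP la.
- rewrite to_part_rem // (perm_trans _ (_ : perm_eq (k :: rem k la) _)) //.
    exact/permPl/perm_sort.
  by rewrite perm_sym perm_to_rem.
Qed.

(** * Divided powers of a series as sums over partitions *)

Section PartitionSeries.
Variables (R : comNzRingType) (j : {rmorphism {poly rat} -> R}) (a : series R).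
Hypothesis a0 : a 0%N = 0.

(** Through [j], the ring [R] receives the rationals, so positive integers are invertible in it. *)
Lemma natr_regular n (x : R) : x *+ n.+1 = 0 -> x = 0.
Proof.
move=> xn0; rewrite -[x]mulr1 -(rmorph1 j).
have -> : 1 = (n.+1%:R^-1)%:P *+ n.+1 :> {poly rat}.
  by rewrite -polyCMn -[X in X%:P]mulr_natl mulfV // Num.Theory.pnatr_eq0.
by rewrite rmorphMn mulrnAr -mulrnAl xn0 mul0r.
Qed.

Lemma theta_inj (f g : series R) : f 0%N = g 0%N -> theta f = theta g -> f = g.
Proof.
move=> fg0 thfg; apply: seriesP => -[//|n]; apply/eqP.
rewrite -subr_eq0; apply/eqP/(@natr_regular n); rewrite mulrnBl.
by rewrite -/(theta f n.+1) -/(theta g n.+1) thfg subrr.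
Qed.

Definition part_term n (la : intpart n) : R :=
  j (((zcoef la)%:R^-1)%:P) * \prod_(i <- la) a i.

(** This is [P^l / l!] for [P = \sum_(k > 0) a_k z^k / k]: collecting the terms of the power by
    multiplicities of exponents produces [1 / z_la]. *)
Definition part_series l : series R :=
  fun n => \sum_(la : intpart n | size la == l) part_term la.

Lemma part_term_ins n k (mu : intpart (n - k)) : (0 < k <= n)%N ->
  part_term (to_part n (sort geq (k :: mu))) *+ (k * (count_mem k mu).+1) =
  a k * part_term mu.
Proof.
move=> k_n; have pE := to_part_ins mu k_n.
rewrite /part_term pE (perm_big (k :: mu)); last exact/permPl/perm_sort.
rewrite big_cons -mulrnAl mulrCA; congr (_ * _); rewrite -rmorphMn -polyCMn /=.
congr (j _%:P * _).
have -> : zcoef (to_part n (sort geq (k :: mu))) =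
    (k * (count_mem k mu).+1 * zcoef mu)%N.
  rewrite /zcoef -/(zseq n _) pE (@zseq_perm _ _ (k :: mu)); last first.
    exact/permPl/perm_sort.
  rewrite zseq_cons //; congr (_ * _)%N; apply: zseq_widen (leq_subr _ _).
  by apply/allP => i; apply: intpart_le.
have c0 : (k * (count_mem k mu).+1)%:R != 0 :> rat.
  by rewrite Num.Theory.pnatr_eq0 muln_eq0 negb_or -lt0n; case/andP: k_n => ->.
by rewrite natrM invfM -[LHS]mulr_natl mulrA divff // mul1r.
Qed.

(** Removing one part [k] is a bijection from the partitions of [n] containing [k] to those of
    [n - k], and it divides [z_la] by [k] times the multiplicity of [k]. Partitions without [k] have
    weight 0. *)
Lemma sum_part_term_rem l n k : (k <= n)%N ->
  \sum_(la : intpart n | size la == l.+1) part_term la *+ (k * count_mem k la) =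
  a k * part_series l (n - k)%N.
Proof.
case: k => [|k] le_kn; first by rewrite a0 mul0r big1.
rewrite (bigID (fun la : intpart n => k.+1 \in parts la)) /= addrC big1 ?add0r.
  rewrite mulr_sumr.
  rewrite (reindex_onto (fun mu : intpart (n - k.+1) => to_part n (sort geq (k.+1 :: mu)))
    (fun la => to_part (n - k.+1) (rem k.+1 la))) /=; last first.
    by move=> la /andP[_ k_la]; apply: remK.
  apply: eq_big => mu.
    by rewrite insK // to_part_ins // size_sort mem_sort mem_head eqxx !andbT eqSS.
  move=> _; rewrite -part_term_ins //; congr (_ *+ (_ * _)).
  rewrite to_part_ins //; have /permPl/seq.permP -> := perm_sort geq (k.+1 :: mu).
  by rewrite /= eqxx.
by move=> la /andP[_ /count_memPn ->]; rewrite muln0.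
Qed.

Lemma sumn_count n s : all (fun i => i <= n)%N s ->
  sumn s = (\sum_(k < n.+1) k * count_mem (k : nat) s)%N.
Proof.
elim: s => [|i s IHs] /=; first by rewrite big1 // => k _; rewrite muln0.
case/andP=> le_i /IHs ->; rewrite -ltnS in le_i.
under [RHS]eq_bigr do rewrite mulnDr.
rewrite big_split; congr (_ + _)%N; rewrite (bigD1 (Ordinal le_i)) //= eqxx muln1.
rewrite big1 ?addn0 // => k.
by rewrite -val_eqE /= eq_sym => /negPf ->; rewrite muln0.
Qed.

(** This is the chain rule for [P^(l+1) / (l+1)!], since [theta P = a]. The factor [n] is
    distributed over the parts as the sum of [k] times the multiplicity of [k]. *)
Lemma theta_part_series l : theta (part_series l.+1) = a * part_series l.
Proof.
apply: seriesP => n; rewrite series_mulE /theta -sumrMnl.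
transitivity (\sum_(la : intpart n | size la == l.+1)
    \sum_(k < n.+1) part_term la *+ (k * count_mem (k : nat) la)).
  apply: eq_bigr => la _; rewrite sumrMnr -sumn_count; last first.
    by apply/allP => i; apply: intpart_le.
  by case/and3P: (valP la) => _ _ /eqP ->.
rewrite exchange_big; apply: eq_bigr => k _ /=.
by rewrite sum_part_term_rem ?leq_ord.
Qed.

Lemma part_series_eq0 l n : (n < l)%N -> part_series l n = 0.
Proof.
move=> lt_nl; apply: big_pred0 => la; apply: contraTF lt_nl => /eqP <-.
by rewrite -leqNgt intpart_size.
Qed.

Lemma intpart0_nil (la : intpart 0) : parts la = [::].
Proof. by apply/nilP; rewrite /nilp -leqn0 intpart_size. Qed.

Lemma part_series0 : part_series 0 = 1.
Proof.
apply: seriesP => -[|n]; rewrite series_oneE /=; last first.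
  apply: big_pred0 => la; apply/negP => /nilP la0.
  by have /and3P[_ _] := valP la; rewrite /= la0.
rewrite /part_series (bigD1 (to_part 0 [::])) ?intpart0_nil //= big1 ?addr0.
  by rewrite /part_term /zcoef intpart0_nil big_nil mulr1 big_nil invr1 rmorph1.
by move=> la /andP[_ /eqP[]]; apply: val_inj; rewrite /= !intpart0_nil.
Qed.

(** Induction on [k + l]: for positive [k] and [l] both sides have zero constant term, and their
    images under [theta] agree by Pascal's rule. *)
Lemma part_seriesM k l :
  part_series k * part_series l = part_series (k + l)%N *+ 'C(k + l, k).
Proof.
have [n] := ubnP (k + l)%N; elim: n k l => // n IHn [|k] [|l] lt_kl.
- by rewrite part_series0 mulr1.
- by rewrite part_series0 mul1r bin0.
- by rewrite part_series0 addn0 binn mulr1 mulr1n.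
apply: theta_inj.
  by rewrite series_mul0 series_mulrnE !part_series_eq0 // mulr0 mul0rn.
rewrite thetaM thetaMn addSn !theta_part_series.
rewrite -mulrA IHn; last by rewrite -ltnS.
rewrite mulrCA IHn; last by rewrite -ltnS -addnS.
rewrite addSnnS -mulrDr -mulrnDr -mulrnAr; congr (_ * (_ *+ _)).
by rewrite binS addnC.
Qed.

(** This is [\sum_l c_l P^l / l!]; stopping at [l = n] loses nothing because [P^l] starts in degree
    [l]. *)
Definition exp_comp (c : nat -> R) : series R :=
  fun n => \sum_(l < n.+1) c l * part_series l n.

Lemma exp_compE N c n : (n <= N)%N ->
  exp_comp c n = \sum_(l < N.+1) c l * part_series l n.
Proof.
move=> le_nN; rewrite -(big_mkord xpredT (fun l => c l * part_series l n)).
rewrite (@big_cat_nat _ _ _ n.+1) // big_mkord /= [X in _ + X]big1_seq ?addr0 //.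
move=> l; rewrite mem_index_iota => /andP[_ /andP[lt_nl _]].
by rewrite part_series_eq0 ?mulr0.
Qed.

Lemma mul_exp_comp f c n :
  (f * exp_comp c) n = \sum_(l < n.+1) c l * (f * part_series l) n.
Proof.
under [RHS]eq_bigr do rewrite series_mulE mulr_sumr.
rewrite series_mulE exchange_big; apply: eq_bigr => i _ /=.
rewrite (@exp_compE n) ?leq_subr // mulr_sumr.
by apply: eq_bigr => l _; rewrite mulrCA.
Qed.

Lemma exp_compM c d : exp_comp c * exp_comp d =
  exp_comp (fun s => \sum_(k < s.+1) (c k * d (s - k)%N) *+ 'C(s, k)).
Proof.
apply: seriesP => n; rewrite mulrC mul_exp_comp.
pose F k l := (c k * d l) *+ 'C(k + l, k) * part_series (k + l)%N n.
transitivity (\sum_(k < n.+1) \sum_(l < n.+1) F k l).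
  apply: eq_bigr => k _; rewrite [exp_comp d * _]mulrC mul_exp_comp mulr_sumr.
  apply: eq_bigr => l _.
  by rewrite part_seriesM series_mulrnE /F mulrA mulrnAr mulrnAl.
rewrite sum_triangle => [|k l lt_n]; last by rewrite /F part_series_eq0 ?mulr0.
apply: eq_bigr => s _; rewrite mulr_suml; apply: eq_bigr => k _.
by rewrite /F subnKC ?leq_ord.
Qed.

Lemma theta_exp_comp c :
  theta (exp_comp c) = a * exp_comp (fun l => c l.+1).
Proof.
apply: seriesP => n; rewrite mul_exp_comp /theta -sumrMnl big_ord_recl.
rewrite part_series0 series_oneE [X in X + _](_ : _ = 0) ?add0r; last first.
  by case: n => [|n] //=; rewrite mulr0 mul0rn.
rewrite [RHS]big_ord_recr /= -[a * part_series n]theta_part_series /theta.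
rewrite part_series_eq0 // mul0rn mulr0 addr0.
by apply: eq_bigr => l _; rewrite -theta_part_series -mulrnAr.
Qed.

Lemma exp_comp0 c : exp_comp c 0%N = c 0%N.
Proof. by rewrite /exp_comp big_ord1 part_series0 series_oneE mulr1. Qed.

(** The hypothesis says that [C(u) = \sum_m b_m u^m / m!] satisfies [C' = C (C - (1 - t))];
    substituting [P] for [u] brings in the factor [theta P = a]. *)
Lemma theta_exp_comp_riccati (b : nat -> R) (t : R) :
    (forall m, b m.+1 = \sum_(k < m.+1) (b k * b (m - k)%N) *+ 'C(m, k) - (1 - t) * b m) ->
  theta (exp_comp b) = a * exp_comp b * (exp_comp b - seriesC (1 - t)).
Proof.
move=> bE; rewrite theta_exp_comp -mulrA; congr (_ * _).
rewrite mulrBr exp_compM mulrC; apply: seriesP => n.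
rewrite series_addE series_oppE seriesC_mul /exp_comp mulr_sumr -sumrB.
by apply: eq_bigr => l _; rewrite bE mulrBl mulrA.
Qed.

(** Since [a P^l / l!] is [theta] of [P^(l+1) / (l+1)!], the index of [c] is one less than the
    number of parts, and the factor [n] comes out. *)
Lemma mul_exp_comp_coef c n : (a * exp_comp c) n =
  (\sum_(la : intpart n) c (size la).-1 * part_term la) *+ n.
Proof.
case: n => [|n]; first by rewrite series_mul0 a0 mul0r.
have size_gt0 (la : intpart n.+1) : (0 < size la)%N.
  by have /and3P[_ _ /=] := valP la; case: (parts la).
rewrite mul_exp_comp.
rewrite (partition_big (fun la : intpart n.+1 => inord (size la).-1 : 'I_n.+2) xpredT) //=.
rewrite -sumrMnl; apply: eq_bigr => l _.
rewrite -theta_part_series /theta mulrnAr mulr_sumr; congr (_ *+ _).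
have szE (la : intpart n.+1) :
    ((inord (size la).-1 : 'I_n.+2) == l) = (size la == l.+1).
  rewrite -val_eqE /= inordK; last by rewrite prednK ?size_gt0 // leqW ?intpart_size.
  by rewrite -eqSS prednK ?size_gt0.
by apply: eq_big => la; [rewrite szE | move/eqP->].
Qed.

End PartitionSeries.

(** * Eulerian polynomials *)

Lemma des_sum w : des w = (\sum_(i < (size w).-1) (nth 0 w i.+1 < nth 0 w i))%N.
Proof.
rewrite /des -sum1_card big_mkcond; apply: eq_bigr => i _.
by rewrite inE; case: ltnP.
Qed.

Lemma des_cons2 a b w : des [:: a, b & w] = ((b < a) + des (b :: w))%N.
Proof. by rewrite !des_sum /= big_ord_recl. Qed.

Lemma des_le1 w : (size w <= 1)%N -> des w = 0%N.
Proof. by case: w => [|a [|b w]] //= _; rewrite des_sum big_ord0. Qed.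

Definition insert_at (i x : nat) (w : seq nat) := take i w ++ x :: drop i w.

Lemma insert_at0 x w : insert_at 0 x w = x :: w.
Proof. by rewrite /insert_at take0 drop0. Qed.

Lemma insert_atS i x a w : insert_at i.+1 x (a :: w) = a :: insert_at i x w.
Proof. by []. Qed.

(* Inserting a new maximum at the end or inside a descent keeps the number of
   descents; anywhere else it adds one. *)
Lemma sum_des_insert (R : comNzRingType) (t : R) M w : all (fun x => x < M)%N w ->
  \sum_(i < (size w).+1) t ^+ des (insert_at i M w) =
  t ^+ des w * (des w).+1%:R + t ^+ (des w).+1 * ((size w)%:R - (des w)%:R).
Proof.
elim: w => [|a w IHw] /=.
  by move=> _; rewrite big_ord1 /insert_at /= !des_le1 // expr0 subrr !mulr0 addr0 mulr1.
case/andP=> lt_aM w_M; have gtaM : (M < a)%N = false by rewrite ltnNge ltnW.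
rewrite big_ord_recl insert_at0 des_cons2 lt_aM.
under eq_bigr => i _ do rewrite lift0 insert_atS.
case: w IHw w_M => [|b w] IHw w_M.
  by rewrite big_ord1 insert_at0 des_cons2 gtaM !des_le1 //= subr0; ring.
have tail : \sum_(i < (size w).+1) t ^+ des (b :: insert_at i M w) =
    t ^+ des (b :: w) * (des (b :: w)).+1%:R +
    t ^+ (des (b :: w)).+1 * ((size w).+1%:R - (des (b :: w))%:R) -
    t ^+ des [:: M, b & w].
  rewrite -(IHw w_M) [in RHS]big_ord_recl insert_at0 addrAC subrr add0r.
  by apply: eq_bigr => i _; rewrite lift0 insert_atS.
case/andP: w_M => lt_bM w_M; rewrite [size _]/= big_ord_recl insert_at0.
under eq_bigr => i _ do rewrite lift0 insert_atS des_cons2 exprD.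
rewrite -mulr_sumr tail !des_cons2 gtaM lt_bM.
rewrite !add0n; case: (b < a)%N; rewrite ?add0n ?add1n;
  move: (des _) (size w) => d n /=; rewrite ?expr0 ?expr1 !exprS; ring.
Qed.

Lemma nth_insert_at_bump i x w k : (i <= size w)%N ->
  nth 0%N (insert_at i x w) (bump i k) = nth 0%N w k.
Proof.
move=> le_i; rewrite /insert_at nth_cat size_takel // /bump; case: (leqP i k) => [le_ik|lt_ki].
  by rewrite /= add1n ltnNge leqW //= subSn //= nth_drop subnKC.
by rewrite /= add0n lt_ki nth_take.
Qed.

Lemma nth_insert_at i x w : (i <= size w)%N -> nth 0%N (insert_at i x w) i = x.
Proof. by move=> le_i; rewrite /insert_at nth_cat size_takel // ltnn subnn. Qed.

(** Each permutation arises uniquely by inserting the maximal value at some position into a smaller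
    one. [sum_des_insert] does the count, and the weight [des] is produced by [t d/dt]. *)
Lemma eulerianS m : eulerian m.+1 =
  (1 + 'X *+ m) * eulerian m + 'X * (1 - 'X) * (eulerian m)^`().
Proof.
rewrite {1}/eulerian (partition_big (fun s : 'S_m.+1 => (s^-1)%g ord_max) xpredT) //=.
transitivity (\sum_(i < m.+1) \sum_(s : 'S_m)
    'X^(des (insert_at i m [seq val (s k) | k : 'I_m])) : {poly rat}).
  apply: eq_bigr => i _.
  rewrite (reindex (lift_perm i ord_max)) /=; last first.
    (* Deleting position [i] and the value [s i] inverts [lift_perm] on the permutations with their
       maximum at [i]. *)
    pose ulsf i (s : 'S_m.+1) k := odflt k (unlift (s i) (s (lift i k))).
    have ulsfK i' (s : 'S_m.+1) k: lift (s i') (ulsf i' s k) = s (lift i' k).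
      rewrite /ulsf; have:= neq_lift i' k.
      by rewrite -(can_eq (permK s)) => /unlift_some[] ? ? ->.
    have inj_ulsf: injective (ulsf i _).
      move=> s; apply: can_inj (ulsf (s i) s^-1%g) _ => k'.
      by rewrite {1}/ulsf ulsfK !permK liftK.
    exists (fun s => perm (inj_ulsf s)) => [s _ | s].
      by apply/permP=> k'; rewrite permE /ulsf lift_perm_lift lift_perm_id liftK.
    rewrite inE => /eqP si0; apply/permP=> k.
    have {}si0 : s i = ord_max by rewrite -si0 permKV.
    case: (unliftP i k) => [k'|] ->; rewrite ?lift_perm_id //.
    by rewrite lift_perm_lift -si0 permE ulsfK.
  apply: eq_big => [s|s _].
    by rewrite -(inj_eq (@perm_inj _ (lift_perm i ord_max s))) permKV lift_perm_id eqxx.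
  congr ('X^(des _)); apply: (@eq_from_nth _ 0%N).
    rewrite size_cat /= size_take_min size_drop !size_image !card_ord; lia.
  move=> k; rewrite size_image card_ord => lt_k.
  have le_i : (i <= size [seq val (s k) | k : 'I_m])%N.
    by rewrite size_image card_ord -ltnS.
  have nthE n (f : 'I_n -> nat) (l : 'I_n) : nth 0%N [seq f x | x : 'I_n] l = f l.
    by rewrite (nth_map l) ?size_enum_ord // nth_ord_enum.
  rewrite -[k]/(val (Ordinal lt_k)) nthE.
  case: (unliftP i (Ordinal lt_k)) => [l|] ->.
    by rewrite lift_perm_lift lift_max nth_insert_at_bump // nthE.
  by rewrite lift_perm_id nth_insert_at.
rewrite exchange_big /eulerian raddf_sum !mulr_sumr -big_split /=.
apply: eq_bigr => s _; set w := [seq _ | _ : 'I_m].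
have sz_w : size w = m by rewrite size_image card_ord.
have := @sum_des_insert {poly rat} 'X m w; rewrite sz_w => ->; last first.
  by apply/allP => _ /mapP[k _ ->].
have dX : 'X * ('X^(des w))^`() = 'X^(des w) *+ des w :> {poly rat}.
  by rewrite derivXn mulrnAr; case: (des w) => // d; rewrite -exprS.
rewrite [X in _ = _ + X]mulrAC dX exprS -natr1.
rewrite -['X *+ m]mulr_natr -['X^(des w) *+ _]mulr_natr.
have aux (A : comNzRingType) (u d e x : A) :
  u * (d + 1) + x * u * (e - d) = (1 + x * e) * u + u * d * (1 - x) by ring.
exact: aux.
Qed.

(** With the factor [t] and the convention [t A_0 = 1], a single recurrence covers [m = 0] as
    well. *)
Lemma tEulerianS m : tEulerian m.+1 =
  ('X * tEulerian m) *+ m.+1 + 'X * (1 - 'X) * (tEulerian m)^`().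
Proof.
case: m => [|m]; rewrite /tEulerian eulerianS.
  have -> : eulerian 0 = 1.
    rewrite /eulerian (eq_bigr (fun=> 1)) => [|s _].
      by rewrite sumr_const card_Sn.
    by rewrite des_le1 // size_map size_enum_ord.
  by rewrite derivC; ring.
rewrite !derivM derivX -['X *+ _]mulr_natr -['X * ('X * _) *+ _]mulr_natr -!natr1.
by ring.
Qed.

(** Coefficientwise, this is the Riccati equation [C' = C^2 - (1 - t) C] of the exponential
    generating function of the [t A_m]. *)
Lemma tEulerian_convolution m : tEulerian m.+1 =
  \sum_(k < m.+1) (tEulerian k * tEulerian (m - k)) *+ 'C(m, k) -
  (1 - 'X) * tEulerian m.
Proof.
elim: m => [|m IHm].
  rewrite tEulerianS big_ord1 subnn bin0 mulr1n /tEulerian derivC; ring.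
(* [L] raises the index [m.+1] to [m.+2]. Splitting [m.+2] as [k.+1 + (m - k).+1] makes it act on
   the products [F k (m - k)] by the Leibniz rule. *)
pose L (f : {poly rat}) := ('X * f) *+ m.+2 + 'X * (1 - 'X) * f^`().
transitivity (L (tEulerian m.+1)); first exact: tEulerianS.
pose F k l := tEulerian k * tEulerian l.
have LF k : (k <= m)%N -> L (F k (m - k)%N) = F k.+1 (m - k)%N + F k (m.+1 - k)%N.
  move=> le_km; rewrite subSn // /L.
  have -> : m.+2 = (k.+1 + (m - k).+1)%N by lia.
  move: (m - k)%N => l; rewrite /F derivM !tEulerianS.
  rewrite -['X * tEulerian k *+ _]mulr_natr -['X * tEulerian l *+ _]mulr_natr.
  rewrite -['X * (_ * _) *+ _]mulr_natr natrD.
  have aux (A : comNzRingType) (x y f g f' g' c d : A) :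
    x * (f * g) * (c + d) + y * (f' * g + f * g') =
    (x * f * c + y * f') * g + f * (x * g * d + y * g') by ring.
  exact: aux.
have LD : {morph L : f g / f + g}.
  by move=> f g; rewrite /L derivD !mulrDr mulrnDl addrACA.
have L0 : L 0 = 0 by rewrite /L derivC !mulr0 mul0rn addr0.
have LMn f k : L (f *+ k) = L f *+ k.
  by elim: k => [|k IHk]; rewrite ?L0 // !mulrS LD IHk.
(* Here the derivative of [1 - 'X] makes up for the excess of [m.+2] over the [m.+1] in
   [tEulerianS]. *)
have LX : L (- ((1 - 'X) * tEulerian m)) = - ((1 - 'X) * tEulerian m.+1).
  rewrite /L tEulerianS derivN derivM derivB derivX derivC.
  rewrite -['X * tEulerian m *+ _]mulr_natr -['X * - _ *+ _]mulr_natr -[m.+2%:R]natr1.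
  have aux (A : comNzRingType) (x f f' c : A) :
    x * - ((1 - x) * f) * (c + 1) + x * (1 - x) * - ((0 - 1) * f + (1 - x) * f') =
    - ((1 - x) * (x * f * c + x * (1 - x) * f')) by ring.
  exact: aux.
rewrite {1}IHm LD LX; congr (_ - _); rewrite (big_morph L LD L0).
transitivity (\sum_(k < m.+1)
    (F k.+1 (m - k)%N *+ 'C(m, k) + F k (m.+1 - k)%N *+ 'C(m, k))).
  by apply: eq_bigr => k _; rewrite LMn LF ?leq_ord // mulrnDl.
rewrite big_split /= [X in _ + X = _]big_ord_recl [RHS]big_ord_recl /= !subn0 !bin0 addrCA.
congr (_ + _).
transitivity (\sum_(k < m.+1)
    (F k.+1 (m - k)%N *+ 'C(m, k) + F k.+1 (m - k)%N *+ 'C(m, k.+1))).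
  rewrite big_split /=; congr (_ + _).
  by rewrite [RHS]big_ord_recr /= bin_small // mulr0n addr0.
by apply: eq_bigr => k _; rewrite -mulrnDr binS addnC.
Qed.

(** * Newton's identities for traces *)

Section DetDeriv.
Variable R : comNzRingType.

Lemma deriv_prod (I : finType) (F : I -> {poly R}) :
  (\prod_i F i)^`() = \sum_i (F i)^`() * \prod_(j | i != j) F j.
Proof.
suff deriv_seq (r : seq I) : uniq r -> (\prod_(i <- r) F i)^`() =
    \sum_(i <- r) (F i)^`() * \prod_(j <- r | i != j) F j.
  by rewrite deriv_seq ?index_enum_uniq.
elim: r => [|a r IHr] /=; first by rewrite !big_nil derivC.
case/andP=> a_r uniq_r; rewrite !big_cons derivM eqxx IHr //; congr (_ * _ + _).
  rewrite [RHS]big_seq_cond [LHS]big_seq; apply: eq_bigl => i.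
  by case: eqVneq => [<-|_]; rewrite ?(negPf a_r) ?andbT.
rewrite mulr_sumr !big_seq; apply: eq_bigr => i i_r; rewrite big_cons.
by case: eqVneq i_r => [->|_ _]; rewrite ?(negPf a_r) // mulrCA.
Qed.

(** Jacobi's formula: in the differentiated Leibniz expansion, the permutations with [s i = j] add
    up to a cofactor. *)
Lemma deriv_det n (A : 'M[{poly R}]_n) :
  (\det A)^`() = \sum_i \sum_j (A i j)^`() * cofactor A i j.
Proof.
rewrite /determinant raddf_sum /=.
transitivity (\sum_(s : 'S_n) \sum_i (A i (s i))^`() *
  ((-1) ^+ s * \prod_(k | i != k) A k (s k))).
  apply: eq_bigr => s _; rewrite !mulr_sign; have -> b (p : {poly R}) :
      (if b then - p else p)^`() = (-1) ^+ b * p^`().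
    by case: b; rewrite ?derivN mulr_sign.
  by rewrite deriv_prod mulr_sumr; apply: eq_bigr => i _; rewrite mulrCA.
rewrite exchange_big /=; apply: eq_bigr => i _.
rewrite (partition_big (fun s : 'S_n => s i) xpredT) //=; apply: eq_bigr => j _.
rewrite expand_cofactor mulr_sumr; apply: eq_bigr => s /eqP <- //.
Qed.

End DetDeriv.

(** Jacobi's formula gives [Q' = - tr (adj A M)] for [A = 1 - z M]; as [adj A] times [A] is [Q],
    multiplying a truncated geometric series by [Q] recovers [- Q'] up to degree [n]. *)
Lemma newton_trace (R : comNzRingType) N (M : 'M[R]_N) n :
  let Q := \det (1%:M - 'X *: map_mx polyC M) in
  \sum_(i < n.+1) Q`_i * \tr (M ^+ (n - i).+1) = - (Q`_n.+1 *+ n.+1).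
Proof.
set MX := map_mx polyC M; set A := 1%:M - _ => Q.
have dQ : Q^`() = - \tr (\adj A *m MX).
  rewrite /Q deriv_det /mxtrace -sumrN exchange_big /=; apply: eq_bigr => j _.
  rewrite mxE -sumrN; apply: eq_bigr => i _.
  have -> : A i j = ((i == j)%:R)%:P - 'X * (M i j)%:P by rewrite !mxE rmorph_nat.
  by rewrite !derivE !mxE sub0r mulr0 addr0 mul1r mulNr mulrC.
(* A truncation of [M / (1 - z M)], whose error term starts in degree [n.+1], out of reach of
   coefficient [n]. *)
pose S := \sum_(j < n.+1) 'X^j *: MX ^+ j.+1.
have AS : A *m S = MX - 'X^(n.+1) *: MX ^+ n.+2.
  rewrite /S mulmx_sumr.
  transitivity (\sum_(j < n.+1) ('X^j *: MX ^+ j.+1 - 'X^(j.+1) *: MX ^+ j.+2)).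
    apply: eq_bigr => j _; rewrite mulmxBl mul1mx -scalemxAl -scalemxAr scalerA.
    by rewrite -exprS (exprS MX j.+1).
  rewrite -(big_mkord xpredT (fun j => 'X^j *: MX ^+ j.+1 - 'X^(j.+1) *: MX ^+ j.+2)).
  rewrite (@telescope_sumr_eq _ _ _ (fun j => - ('X^j *: MX ^+ j.+1))) // => [|j _].
    by rewrite opprK addrC expr0 scale1r expr1.
  by rewrite opprK addrC.
have trS : Q * \tr S = - Q^`() - 'X^(n.+1) * \tr (\adj A *m MX ^+ n.+2).
  rewrite -mxtraceZ -mul_scalar_mx -mul_adj_mx -mulmxA AS mulmxBr raddfB /=.
  by rewrite dQ opprK -scalemxAr mxtraceZ.
have /(congr1 (fun p : {poly R} => p`_n)) := trS.
rewrite coefB coefN coef_deriv coefXnM ltnSn subr0 coefM => <-.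
apply: eq_bigr => i _; congr (_ * _); rewrite raddf_sum /= coef_sum.
have trMX k : \tr (MX ^+ k) = (\tr (M ^+ k))%:P.
  by rewrite -rmorphXn raddf_sum; apply: eq_bigr => j _; rewrite mxE.
have lt_i : (n - i < n.+1)%N by rewrite ltnS leq_subr.
rewrite (bigD1 (Ordinal lt_i)) //= big1 => [|j]; last first.
  rewrite -val_eqE /= => j_neq.
  by rewrite mxtraceZ trMX mulrC coefCM coefXn eq_sym (negPf j_neq) mulr0.
by rewrite addr0 mxtraceZ trMX mulrC coefCM coefXn eqxx mulr1.
Qed.

(** * The transfer matrix of Smirnov words *)

(** A column operation identifies the left side with the determinant of a bordered matrix in which
    [s] occurs only in the first row, and a determinant is linear in a row. *)
Lemma det_rank1_affine (R : comNzRingType) N (A : 'M[R]_N) (u : 'cV[R]_N) :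
  exists f1, forall s, \det (A - s *: (u *m const_mx 1)) = \det A + s * f1.
Proof.
pose B b s : 'M[R]_(1 + N) := block_mx b%:M (const_mx s) u A.
exists (\det (B 0 1)) => s.
have BE : \det (B 1 s) = \det (A - s *: (u *m const_mx 1)).
  have <- : \det (B 1 s *m block_mx 1%:M (const_mx (- s)) 0 1%:M) = \det (B 1 s).
    by rewrite det_mulmx det_ublock !det1 !mulr1.
  rewrite mulmx_block !mul1mx !mulmx1 !mulmx0 !addr0.
  have -> : const_mx (- s) + const_mx s = 0 :> 'M[R]_(1, N).
    by apply/matrixP => i k; rewrite !mxE addNr.
  rewrite det_lblock det1 mul1r addrC; congr (\det (_ + _)).
  rewrite -scaleNr scalemxAr; congr (u *m _).
  by apply/matrixP => i k; rewrite !mxE mulr1.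
have B0 : \det (B 1 0) = \det A.
  by rewrite /B (_ : const_mx 0 = 0) // det_lblock det1 mul1r.
rewrite -BE -B0 -[\det (B 1 0)]mul1r.
have row'_B b b' r r' : row' (lshift N ord0) (B b r) = row' (lshift N ord0) (B b' r').
  apply/matrixP => i k; rewrite [LHS]mxE [RHS]mxE.
  have -> : lift (lshift N ord0) i = rshift 1 i by apply: val_inj.
  by rewrite /B /block_mx !col_mxEd.
apply: (determinant_multilinear (i0 := lshift N ord0)) => //.
rewrite /B /block_mx !rowKu; apply/rowP => k; rewrite !mxE.
by case: split => l; rewrite !mxE ?mul0rn ?mulr0 ?addr0 ?mul1r ?mulr1 ?add0r.
Qed.

(** Subtracting [s] times the rank one matrix with rows constant equal to [u i] leaves a triangular
    matrix for [s = t] and for [s = 1]. These two values of an affine function of [s] determine its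
    value at 0. *)
Lemma det_two_triangles (R : comNzRingType) N (A : 'M[R]_N) (t : R) (u : 'I_N -> R) :
    (forall i k : 'I_N, (i < k)%N -> A i k = u i) ->
    (forall i k : 'I_N, (k < i)%N -> A i k = t * u i) ->
  (1 - t) * \det A = \prod_i (A i i - t * u i) - t * \prod_i (A i i - u i).
Proof.
move=> Aup Alow; have [f1 f1E] := det_rank1_affine A (\col_i u i).
have E s i k : (A - s *: (\col_i u i *m const_mx 1)) i k = A i k - s * u i.
  by rewrite !mxE big_ord1 !mxE mulr1.
have ft := f1E t; have fu := f1E 1.
rewrite -det_tr det_trig in ft; last first.
  by apply/is_trig_mxP => i k lt_ik; rewrite mxE E Alow // subrr.
rewrite det_trig in fu; last first.
  by apply/is_trig_mxP => i k lt_ik; rewrite E Aup // mul1r subrr.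
transitivity (\det A + t * f1 - t * (\det A + 1 * f1)); first by ring.
rewrite -ft -fu; congr (_ - _ * _); apply: eq_bigr => i _.
  by rewrite mxE E.
by rewrite E mul1r.
Qed.

Lemma coef_prod_1DX (R : comNzRingType) N (c : 'I_N -> R) k :
  (\prod_i (1 + (c i)%:P * 'X))`_k = \sum_(h : {set 'I_N} | #|h| == k) \prod_(i in h) c i.
Proof.
under eq_bigr => i _ do rewrite addrC.
rewrite bigA_distr coef_sum [RHS]big_mkcond; apply: eq_bigr => h _ /=.
rewrite -big_mkcond big_split /= prodr_const -rmorph_prod coefCM coefXn eq_sym.
by case: eqP => _; rewrite ?mulr1 ?mulr0.
Qed.

Lemma subX1_regular (R : comNzRingType) (f : {poly R}) : (1 - 'X) * f = 0 -> f = 0.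
Proof.
move=> f0; apply: (@monic_lreg _ ('X - 1%:P)); first exact: monicXsubC.
by rewrite mulr0; apply/eqP; rewrite -oppr_eq0 -mulNr opprB f0.
Qed.

Lemma tintE (m : nat) : (1 - 'X) * tint m = 1 - 'X^m.
Proof. by rewrite /tint -opprB mulNr -subrX1 opprB. Qed.

(** * Derivatives of traces of powers *)

Section DerivTrace.
Variables (R : comNzRingType) (N : nat).
Implicit Types M : 'M[{poly R}]_N.

Let deriv_mx M := map_mx (@deriv R) M.

Lemma deriv_mulmx M M' : deriv_mx (M *m M') = deriv_mx M *m M' + M *m deriv_mx M'.
Proof.
apply/matrixP => i k; rewrite !mxE raddf_sum -big_split /=.
by apply: eq_bigr => l _; rewrite !mxE derivM.
Qed.

(** The product rule gives one term for each factor, and cyclicity of the trace makes them all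
    equal. *)
Lemma deriv_trace_exp M n :
  (\tr (M ^+ n.+1))^`() = \tr (map_mx (@deriv R) M *m M ^+ n) *+ n.+1.
Proof.
have mulmx_exp l k : M ^+ l *m M ^+ k = M ^+ (l + k) by rewrite exprD.
have E l k : \tr (deriv_mx (M ^+ l) *m M ^+ k) =
    \tr (deriv_mx M *m M ^+ (l + k).-1) *+ l.
  elim: l k => [|l IHl] k.
    rewrite expr0 [deriv_mx _](_ : _ = 0) ?mul0mx ?mxtrace0 //.
    by apply/matrixP => i i'; rewrite !mxE; case: eqP => _; rewrite derivC.
  rewrite exprS deriv_mulmx mulmxDl raddfD /= -mulmxA mulmx_exp mulrS.
  congr (_ + _); rewrite -mulmxA mxtrace_mulC -mulmxA -{3}[M]expr1 mulmx_exp addn1 IHl.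
  by rewrite addnS.
have := E n.+1 0%N; rewrite expr0 mulmx1 addn0 => <-.
by rewrite /mxtrace raddf_sum; apply: eq_bigr => i _; rewrite mxE.
Qed.

End DerivTrace.

Lemma big_tuple_cons (V : nmodType) (T : finType) m (F : m.+1.-tuple T -> V) :
  \sum_w F w = \sum_x \sum_(w : m.-tuple T) F [tuple of x :: w].
Proof.
rewrite pair_bigA /= (reindex (fun p : T * m.-tuple T => [tuple of p.1 :: p.2])) //=.
exists (fun w => (thead w, [tuple of behead w])) => [[x w] _ | w _].
  by congr (_, _); apply: val_inj.
by rewrite [RHS]tuple_eta.
Qed.

(** * Words as paths of the transfer matrix *)

Section SmirnovMatrix.
Variable N : nat.
Implicit Types (i k : 'I_N) (w : seq 'I_N).
Notation K := {mpoly rat[N]}.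

Definition smirnov_mx : 'M[{poly K}]_N :=
  \matrix_(i, k) (('X_i)%:P * (if (i < k)%N then 1 else if (k < i)%N then 'X else 0)).

Definition poly_tint (A : algType rat) m : {poly A} := map_poly (in_alg A) (tint m).

Lemma poly_tintE (A : comAlgType rat) m : (1 - 'X) * poly_tint A m = 1 - 'X^m.
Proof.
have := congr1 (map_poly (in_alg A)) (tintE m).
by rewrite rmorphM !rmorphB !rmorph1 /= map_polyXn map_polyX.
Qed.

(** [det_two_triangles] applies with [u i = - x_i z], and the two products become [E(tz)] and
    [E(z)]. The factor [1 - t] is then cancelled. *)
Lemma coef_det_smirnov m :
  (\det (1%:M - 'X *: map_mx polyC smirnov_mx))`_m =
  (1 - poly_tint K m) * (mesym N rat m)%:P.
Proof.
set Q := \det _.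
have QE : (1 - 'X)%:P * Q = \prod_(i < N) (1 + ('X * ('X_i)%:P)%:P * 'X)
    - 'X%:P * \prod_(i < N) (1 + (('X_i)%:P)%:P * 'X).
  have lt_neq i k : (i < k)%N -> (i == k) = false.
    by move=> lt_ik; rewrite -val_eqE ltn_eqF.
  rewrite polyCB /Q (@det_two_triangles {poly {poly K}} N _ 'X%:P
    (fun i => - ((('X_i)%:P)%:P * 'X))).
  - congr (_ - _ * _); apply: eq_bigr => i _.
      by rewrite !mxE eqxx !ltnn !mulr0 subr0 mulrN opprK mulrA -rmorphM.
    by rewrite !mxE eqxx !ltnn !mulr0 subr0 opprK.
  - by move=> i k lt_ik; rewrite !mxE lt_neq // lt_ik mulr1 sub0r mulrC.
  - move=> i k lt_ki; rewrite !mxE eq_sym lt_neq // ltnNge ltnW //= lt_ki sub0r.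
    by rewrite rmorphM /= mulrN mulrC mulrA [_ * 'X%:P]mulrC.
apply/eqP; rewrite -subr_eq0; apply/eqP/subX1_regular.
rewrite mulrBr mulrA mulrBr mulr1 poly_tintE.
have := congr1 (fun p : {poly {poly K}} => p`_m) QE.
rewrite coefCM coefB coefCM !coef_prod_1DX /= => ->.
have mesymP : (mesym N rat m)%:P =
    \sum_(h : {set 'I_N} | #|h| == m) \prod_(i in h) ('X_i)%:P :> {poly K}.
  rewrite /mesym rmorph_sum; apply: eq_bigr => h _.
  by rewrite rmorph_prod.
rewrite -mesymP.
have -> : \sum_(h : {set 'I_N} | #|h| == m) \prod_(i in h) ('X * ('X_i)%:P) =
    'X^m * (mesym N rat m)%:P :> {poly K}.
  rewrite mesymP mulr_sumr; apply: eq_bigr => h /eqP <-.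
  by rewrite big_split /= prodr_const.
ring.
Qed.

Fixpoint path_weight i w : {poly K} :=
  if w is k :: w' then smirnov_mx i k * path_weight k w' else 1.

Lemma smirnov_mxX m i k : (smirnov_mx ^+ m) i k =
  \sum_(w : m.-tuple 'I_N) (last i w == k)%:R * path_weight i w.
Proof.
elim: m i => [|m IHm] i.
  rewrite expr0 mxE (big_pred1 [tuple]) /= ?mulr1 // => w.
  by rewrite [w]tuple0; apply/esym/eqP.
rewrite exprS mxE big_tuple_cons; apply: eq_bigr => k' _; rewrite IHm mulr_sumr.
by apply: eq_bigr => w _ /=; rewrite mulrCA.
Qed.

(** A matrix entry carries the variable of its row, so a path lacks the variable of its last letter,
    which is supplied here. *)
Lemma path_weightE i w : path_weight i w * ('X_(last i w))%:P =
  if smirnov (map val (i :: w))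
  then (\prod_(k <- i :: w) 'X_k) *: 'X^(des (map val (i :: w))) else 0.
Proof.
elim: w i => [|k w IHw] i.
  by rewrite /= mul1r des_le1 // big_seq1 expr0 alg_polyC.
rewrite [last i _]/= [path_weight i _]/= -mulrA IHw.
rewrite [smirnov (map _ _)]/= /smirnov /= (big_cons _ _ i) mxE.
case: (path _ _ _) => /=; last by rewrite andbF mulr0.
rewrite andbT des_cons2 -!mul_polyC rmorphM /=.
case: ltngtP => _ /=; last by rewrite mulr0 mul0r.
  by rewrite mulr1 mulrA.
by rewrite add1n exprS; ring.
Qed.

(** In [tr (M' M^m)] the differentiated entry closes the word from its last letter to its first. It
    survives only at a descent, that is when [w_1 < w_n]; it then has lost its [t] and supplies the
    missing variable. *)
Lemma smirnov_lt_trace m : smirnov_lt N m.+1 *+ m.+1 = (\tr (smirnov_mx ^+ m.+1))^`().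
Proof.
rewrite deriv_trace_exp; congr (_ *+ _).
transitivity (\sum_i \sum_k (smirnov_mx k i)^`() * (smirnov_mx ^+ m) i k); last first.
  rewrite exchange_big; apply: eq_bigr => k _; rewrite [RHS]mxE.
  by apply: eq_bigr => i _; congr (_ * _); rewrite [RHS]mxE.
rewrite /smirnov_lt big_mkcond big_tuple_cons; apply: eq_bigr => i _.
under [RHS]eq_bigr => k _ do rewrite smirnov_mxX mulr_sumr.
rewrite [RHS]exchange_big; apply: eq_bigr => w _ /=.
rewrite (bigD1 (last i w)) //= eqxx mul1r [X in _ + X]big1 ?addr0; last first.
  by move=> k; rewrite eq_sym => /negPf ->; rewrite mul0r mulr0.
have := path_weightE i w => /=; rewrite last_map mxE derivM derivC mul0r add0r.
case: (ltngtP i (last i w)) => _; rewrite ?derivC ?derivX ?mulr0 ?mul0r ?andbF //.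
by rewrite andbT mulr1 mulrC => ->.
Qed.

End SmirnovMatrix.

(** * Symmetric functions *)

Lemma mcoeffMX_cond N (p : {mpoly rat[N]}) (u m : 'X_{1..N}) :
  (p * 'X_[u])@_m = if (u <= m)%MM then p@_(m - u) else 0.
Proof.
case: ifP => [le_um|/negP nle_um].
  by rewrite -{1}(submK le_um) addmC mcoeffMX.
rewrite {1}[p]mpolyE mulr_suml raddf_sum big1 //= => m' _.
rewrite -scalerAl -mpolyXD mcoeffZ mcoeffX; case: eqP => [def_m|]; last by rewrite mulr0.
by case: nle_um; rewrite -def_m lem_addl.
Qed.

(** At a monomial [m] of degree [n], the right side counts the pairs of a variable [l] and an
    exponent from 1 to [m l]; there are [mdeg m = n] of them. *)
Lemma newton_mhsym N n :
  mhsym N n *+ n = \sum_(i < n) mpsum N i.+1 * mhsym N (n - i.+1).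
Proof.
apply/mpolyP => m; rewrite mcoeffMn mcoeff_mhsym raddf_sum /=.
transitivity (\sum_(i < n) \sum_(l < N) ((i < m l)%N && (mdeg m == n))%:R : rat).
  have [mn|_] := eqVneq (mdeg m) n; last first.
    by rewrite mul0rn big1 // => i _; rewrite big1 // => l _; rewrite andbF.
  rewrite exchange_big -{1}mn mdegE natr_sum; apply: eq_bigr => l _.
  have le_l : (m l <= n)%N by rewrite -mn mdegE (bigD1 l) //= leq_addr.
  under eq_bigr => i _ do rewrite andbT.
  rewrite -natr_sum -[in LHS](card_ord (m l)) -sum1_card (big_ord_widen n (fun=> 1%N)) //.
  by rewrite big_mkcond; congr _%:R; apply: eq_bigr => i _; case: ltnP.
apply: eq_bigr => i _; rewrite /mpsum mulr_suml raddf_sum; apply: eq_bigr => l _ /=.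
rewrite mulrC mpolyXn mcoeffMX_cond mcoeff_mhsym.
have -> : ((U_(l) *+ i.+1)%MM <= m)%MM = (i < m l)%N.
  apply/mnm_lepP/idP => [/(_ l)|lt_i k]; first by rewrite mulmnE mnm1E eqxx mul1n.
  by rewrite mulmnE mnm1E; case: eqP => [<-|_]; rewrite ?mul1n.
case: ltnP => //= lt_il.
have -> : m = (m - U_(l) *+ i.+1 + U_(l) *+ i.+1)%MM.
  rewrite submK //; apply/mnm_lepP => k.
  by rewrite mulmnE mnm1E; case: eqP => [<-|_]; rewrite ?mul1n.
rewrite addmK mdegD mdegMn mdeg1 mul1n; congr (nat_of_bool _)%:R.
by rewrite -[RHS](eqn_add2r i.+1) subnK.
Qed.

Definition homogeneous_series : series symfun := homogeneous.
(** The constant term is set to 0, [power_sum 0] being the placeholder 1. *)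
Definition power_sum_series : series symfun :=
  fun k => if k is 0 then 0 else power_sum k.

Lemma symfun_trunc_inj (f g : symfun) : (forall N, trunc N f = trunc N g) -> f = g.
Proof. by move=> eq_fg; apply: val_inj; apply: famP. Qed.

Lemma theta_homogeneous : theta homogeneous_series = power_sum_series * homogeneous_series.
Proof.
apply: seriesP => n; apply: symfun_trunc_inj => N.
rewrite /theta raddfMn series_mulE big_ord_recl mul0r add0r raddf_sum.
exact: newton_mhsym.
Qed.

Lemma homogeneous0 : homogeneous 0 = 1.
Proof.
apply: symfun_trunc_inj => N; rewrite rmorph1; apply/mpolyP => m.
by rewrite mcoeff_mhsym mcoeff1 mdeg_eq0.
Qed.

Lemma elementary0 : elementary 0 = 1.
Proof.
by apply: symfun_trunc_inj => N; rewrite rmorph1; apply: mesym0E.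
Qed.

Lemma poly_tint0 (A : comAlgType rat) : poly_tint A 0 = 0.
Proof. by rewrite /poly_tint /tint big_ord0 rmorph0. Qed.

Lemma poly_tint_map (A B : comAlgType rat) (f : {lrmorphism A -> B}) m :
  map_poly f (poly_tint A m) = poly_tint B m.
Proof.
rewrite /poly_tint -map_poly_comp; apply: eq_map_poly => c /=.
by rewrite linearZ /= rmorph1.
Qed.

(* For f = e this is det (1 - z M), M being the transfer matrix of Smirnov
   words. *)
Definition tint_twist (A : comAlgType rat) (f : nat -> A) : series {poly A} :=
  fun k => (1 - poly_tint A k) * (f k)%:P.

Lemma tint_twist_map (A B : comAlgType rat) (h : {lrmorphism A -> B}) f :
  map_series (map_poly h) (tint_twist f) = tint_twist (h \o f).
Proof.
apply: seriesP => k; rewrite /map_series /tint_twist rmorphM rmorphB rmorph1 /=.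
by rewrite poly_tint_map map_polyC.
Qed.

Lemma tint_twist0 (A : comAlgType rat) (f : nat -> A) : f 0%N = 1 -> tint_twist f 0 = 1.
Proof. by move=> f0; rewrite /tint_twist poly_tint0 f0 subr0 mulr1. Qed.

Lemma theta_map (R S : comNzRingType) (f : {rmorphism R -> S}) u :
  theta (map_series f u) = map_series f (theta u).
Proof. by apply: seriesP => n; rewrite /theta /map_series rmorphMn. Qed.

Lemma map_series_opp (R S : comNzRingType) (f : {rmorphism R -> S}) u :
  map_series f (- u) = - map_series f u.
Proof. by apply: seriesP => n; apply: rmorphN. Qed.

Lemma map_series1 (R S : comNzRingType) (f : {rmorphism R -> S}) :
  map_series f 1 = 1.
Proof. by apply: seriesP => n; apply: rmorph_nat. Qed.

Lemma series_cancel (R : comNzRingType) (f g u v : series R) :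
  f * g = 1 -> f * u = f * v -> u = v.
Proof. by move=> fg fuv; rewrite -[u]mul1r -[v]mul1r -fg ![f * g]mulrC -!mulrA fuv. Qed.

Lemma newton_smirnov N :
  tint_twist (mesym N rat) * (fun n => if n is 0 then 0 else \tr (smirnov_mx N ^+ n)) =
  - theta (tint_twist (mesym N rat)).
Proof.
apply: seriesP => -[|n]; first by rewrite series_mul0 mulr0 series_oppE /theta mulr0n oppr0.
rewrite series_mulE big_ord_recr /= subnn mulr0 addr0.
have QE k : tint_twist (mesym N rat) k =
    (\det (1%:M - 'X *: map_mx polyC (smirnov_mx N)))`_k.
  by rewrite coef_det_smirnov.
rewrite series_oppE /theta QE -newton_trace; apply: eq_bigr => i _.
by rewrite QE subSn ?leq_ord.
Qed.

(** This is the relation of [newton_smirnov] with [h_k] in place of [e_k], solved explicitly; the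
    convolution identity for [tEulerian] supplies the Riccati equation. *)
Lemma newton_homogeneous :
  let p := map_series polyC power_sum_series in
  let a : series {poly symfun} := fun n => poly_tint symfun n * p n in
  tint_twist homogeneous *
    (a * exp_comp (map_poly (in_alg symfun)) a
           (fun l => map_poly (in_alg symfun) (tEulerian l)) - p) =
  - theta (tint_twist homogeneous).
Proof.
move=> p a; set U := exp_comp _ _ _.
have a0 : a 0%N = 0 by rewrite /a poly_tint0 mul0r.
have j1X : map_poly (in_alg symfun) (1 - 'X) = 1 - 'X.
  by rewrite rmorphB rmorph1 /= map_polyX.
apply: (@newton_quotient _ 'X (map_series polyC homogeneous_series) p a _ U
  (poly_tint symfun)) => //.
- exact: (natr_regular (map_poly (in_alg symfun))).
- exact: subX1_regular.
- exact: poly_tintE.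
- exact: poly_tint0.
- by rewrite /map_series /homogeneous_series homogeneous0.
- by rewrite theta_map theta_homogeneous map_seriesM.
- by rewrite /U exp_comp0 rmorph1.
- apply: theta_exp_comp_riccati => // m.
  rewrite tEulerian_convolution rmorphB rmorphM /= j1X rmorph_sum.
  by congr (_ - _); apply: eq_bigr => k _; rewrite rmorphMn rmorphM.
Qed.

Lemma map_polyZ_alg (A B : comAlgType rat) (f : {lrmorphism A -> B}) c q :
  map_poly f (c%:A *: q) = c%:A *: map_poly f q.
Proof. by rewrite map_polyZ; congr (_ *: _); apply: rmorph_alg. Qed.

Lemma natr_alg_scaleK (A : comAlgType rat) m (f : {poly A}) :
  (m.+1%:R^-1)%:A *: (f *+ m.+1) = f.
Proof.
rewrite -scalerMnr !scalerMnl -[_ *+ m.+1]mulr_natl mulfV.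
  by rewrite !scale1r.
by rewrite Num.Theory.pnatr_eq0.
Qed.

Lemma part_term_power_sum n (la : intpart n) :
  part_term (map_poly (in_alg symfun))
    (fun k => poly_tint symfun k * map_series polyC power_sum_series k) la =
  ((zcoef la)%:R^-1 *: power_sum_part la)%:P *
    map_poly (in_alg symfun) (\prod_(i <- la) tint i).
Proof.
rewrite /part_term big_split /= map_polyC /= rmorph_prod mulrCA mulrC.
congr (_ * _); last by rewrite rmorph_prod.
rewrite -[in RHS]mulr_algl polyCM; congr (_ * _); rewrite /power_sum_part rmorph_prod.
rewrite !big_seq; apply: eq_bigr => -[|k] // la0.
by have /and3P[_ /negP[]] := valP la.
Qed.

Unset Implicit Arguments.
Set Strict Implicit.

(* omega is characterised by omegaE, as symfun is freely generated as a
   rational algebra by the elementary symmetric functions.  W is determined by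
   its truncations: the first conjunct says that W_n^<(x,t) is a polynomial in
   t with symmetric function coefficients, namely W. *)
Theorem theorem4p3
  (omega : {lrmorphism symfun -> symfun})
  (omegaE : forall k, omega (elementary k) = homogeneous k)
  (n : nat) (n_gt0 : (0 < n)%N) :
  exists2 W : {poly symfun},
    forall N, map_poly (trunc N) W = smirnov_lt N n &
    map_poly omega W =
      \sum_(la : intpart n)
        ((zcoef la)%:R^-1 *: power_sum_part la) *:
        map_poly (in_alg symfun)
          (tEulerian (size la).-1 * \prod_(i <- la) tint i)^`().
Proof.
pose Q := tint_twist elementary.
have [g Qg] : exists g, Q * g = 1 by apply/series_inverse/tint_twist0/elementary0.
(* [T] lifts the traces [tr M^n] to symmetric functions: it is the only solution of Newton's
   relation, [Q] being invertible. *)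
pose T := - theta Q * g.
have QT : Q * T = - theta Q by rewrite /T mulrCA Qg mulr1.
(* By uniqueness, a homomorphism sends [T] to any known solution of the transported relation; this
   is used for the truncations and for [omega]. *)
have cancelQ (B : comAlgType rat) (f : {lrmorphism symfun -> B}) u :
    tint_twist (f \o elementary) * u = - theta (tint_twist (f \o elementary)) ->
    map_series (map_poly f) T = u.
  rewrite -tint_twist_map -/Q => Qu.
  apply: (@series_cancel _ (map_series (map_poly f) Q) (map_series (map_poly f) g)).
    by rewrite -map_seriesM Qg map_series1.
  by rewrite -map_seriesM QT map_series_opp -theta_map Qu.
(* The witness comes from [n W_n^< = d/dt (tr M^n)]. *)
exists ((n%:R^-1)%:A *: (T n)^`()).
  move=> N; rewrite (map_polyZ_alg (trunc N)) -deriv_map.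
  rewrite -[map_poly _ (T n)]/(map_series (map_poly (trunc N)) T n).
  rewrite (cancelQ _ (trunc N : {lrmorphism _ -> _}) _ (newton_smirnov N)).
  case: n n_gt0 => // m _.
  by rewrite -smirnov_lt_trace natr_alg_scaleK.
rewrite (map_polyZ_alg omega) -deriv_map.
rewrite -[map_poly _ (T n)]/(map_series (map_poly omega) T n).
have omega_e : omega \o elementary = homogeneous by apply: functional_extensionality_dep.
have := cancelQ _ omega; rewrite omega_e => cancel_omega.
rewrite (cancel_omega _ newton_homogeneous) series_addE series_oppE.
(* The term [p_n] is constant in [t], so the derivative kills it. *)
rewrite derivB [X in _ - X](_ : _ = 0) ?subr0; last exact: derivC.
rewrite mul_exp_comp_coef; last by rewrite poly_tint0 mul0r.
case: n n_gt0 => // m _; rewrite derivMn natr_alg_scaleK raddf_sum.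
apply: eq_bigr => la _ /=; rewrite part_term_power_sum mulrA [_ * _%:P]mulrC.
by rewrite -mulrA -rmorphM mul_polyC derivZ deriv_map.
Qed.
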